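(* Let $\mu$ be the probability measure on $[-1,1]^2\subset\mathbb{R}^2$ with density $\tfrac12 \mathbf{1}_{\{x_1x_2<0\}}$ with respect to Lebesgue measure on $[-1,1]^2$, and let $\nu=\tfrac12\mathcal{H}^1|_S$, where $S=[-1,1]\times\{0\}$ and $\mathcal H^1$ is one-dimensional Hausdorff measure. Then the Knothe-Rosenblatt map from $\mu$ to $\nu$ is $T(x_1,x_2)=(2x_1+\mathrm{sgn}(x_2),0)$ ($\mu$-a.e.), whereas for every $\varepsilon>0$ the optimal transport map from $\mu$ to $\nu$ for the cost $c_\varepsilon(x,y)=\varepsilon(x_1-y_1)^2+(x_2-y_2)^2$ is $T^0(x_1,x_2)=(x_1,0)$. In particular, the optimal transport maps for $c_\varepsilon$ do not converge to the Knothe-Rosenblatt map as $\varepsilon\to 0$.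
   Context: Knothe-Rosenblatt map in $\mathbb{R}^2$ (last coordinate first): let $\mu^2,\nu^2$ be the marginals of $\mu,\nu$ on the second coordinate, and $\mu^1_{x_2}$, $\nu^1_{y_2}$ the conditional laws of the first coordinate given the second. $T_2=T_2(x_2)$ is the nondecreasing map transporting $\mu^2$ onto $\nu^2$; $T_1(\cdot,x_2)$ is the nondecreasing map transporting $\mu^1_{x_2}$ onto $\nu^1_{T_2(x_2)}$; and $T(x_1,x_2)=(T_1(x_1,x_2),T_2(x_2))$. The optimal transport map for $c_\varepsilon$ is the map $S$ minimizing $\int c_\varepsilon(x,S(x))\,d\mu(x)$ among Borel maps with $S_\sharp\mu=\nu$. *)

(* Defs.v *)
From HB Require Import structures.
From mathcomp Require Import all_boot all_order all_algebra.
From mathcomp Require Import all_classical all_reals all_analysis.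
From mathcomp Require Import measurable_realfun.
From mathcomp Require Import ring lra.

Set Implicit Arguments.
Unset Strict Implicit.
Unset Printing Implicit Defensive.

Import Order.TTheory GRing.Theory Num.Theory.
Import numFieldNormedType.Exports.

Local Open Scope classical_set_scope.
Local Open Scope ring_scope.

(* Points of the plane are pairs [x : R * R], with x_1 = x.1 and x_2 = x.2. *)

Section euclidean_plane.
Context {R : realType}.
Implicit Types (x y : R * R) (U A : set (R * R)).

(* The library norm on [R * R] is the sup norm, hence the explicit formula. *)
Definition eucl_dist x y : R :=
  Num.sqrt ((x.1 - y.1) ^+ 2 + (x.2 - y.2) ^+ 2).

(* Adding 0 to the set gives the empty set the diameter 0 instead of -oo. *)
Definition eucl_diam U : \bar R :=
  ereal_sup (0%E |` [set (eucl_dist p.1 p.2)%:E | p in U `*` U]).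

Definition hausdorff1_delta (delta : R) A : \bar R :=
  ereal_inf [set (\sum_(0 <= i <oo) eucl_diam (U i))%E |
    U in [set U : (set (R * R))^nat |
      (forall i, (eucl_diam (U i) <= delta%:E)%E) /\ A `<=` \bigcup_i U i]].

(* One-dimensional Hausdorff measure; [hausdorff1_delta] is nonincreasing in
   delta, so its supremum over delta > 0 is its limit as delta tends to 0. *)
Definition hausdorff1 A : \bar R :=
  ereal_sup [set hausdorff1_delta delta A | delta in [set d : R | 0 < d]].

End euclidean_plane.

Section source_and_target.
Context {R : realType}.
Local Open Scope ereal_scope.

Definition source_square : set (R * R) := `[(-1)%R, 1%R] `*` `[(-1)%R, 1%R].

Definition target_segment : set (R * R) := `[(-1)%R, 1%R] `*` [set 0%R].

Definition source_density (x : R * R) : R :=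
  (2^-1 * \1_[set z : R * R | z.1 * z.2 < 0] x)%R.

Definition source_measure (A : set (R * R)) : \bar R :=
  \int[lebesgue_measure \x lebesgue_measure]_(x in A `&` source_square)
    (source_density x)%:E.

Definition target_measure (A : set (R * R)) : \bar R :=
  (2^-1)%:E * hausdorff1 (A `&` target_segment).

End source_and_target.

Section hausdorff_line.
Context {R : realType}.
Local Open Scope ereal_scope.
Implicit Types (U A : set (R * R)) (B : set R).

Lemma eucl_diam_ge0 U : 0 <= eucl_diam U.
Proof. by apply: ereal_sup_ubound; left. Qed.

Lemma eucl_diam_set0 : eucl_diam (set0 : set (R * R)) = 0.
Proof.
rewrite /eucl_diam setX0 image_set0 setU0.
by rewrite ereal_sup1.
Qed.

Lemma eucl_dist_ge0 (x y : R * R) : (0 <= eucl_dist x y)%R.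
Proof. exact: sqrtr_ge0. Qed.

Let T := g_sigma_algebraType (@setT (set (R * R))).
Let g (d : R) (U : set T) : \bar R :=
  if eucl_diam U <= d%:E then eucl_diam U else +oo.

Let g_ge0 d U : 0 <= g d U.
Proof. by rewrite /g; case: ifP => // _; exact: eucl_diam_ge0. Qed.

Let hdE d A : hausdorff1_delta d A = (mu_ext (g d) : set T -> \bar R) A.
Proof.
apply/eqP; rewrite eq_le; apply/andP; split.
  apply: le_ereal_inf_tmp => _ /= [U [_ AU] <-].
  have [h|] := pselect (forall i, eucl_diam (U i) <= d%:E).
    apply: ereal_inf_lbound; exists U => //.
    by apply: eq_eseriesr => i _; rewrite /g h.
  move/existsNP => [i /negP hi].
  rewrite (@eseries_pinfty _ (fun k => g d (U k)) xpredT i) ?leey//.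
    by move=> n _; rewrite -ltNye (lt_le_trans _ (g_ge0 _ _)).
  by rewrite /g (negbTE hi).
apply: le_ereal_inf_tmp => _ /= [U [Ud AU] <-].
apply: ereal_inf_lbound; exists U.
  by split => // i; exact: sub_sigma_algebra.
by apply: eq_eseriesr => i _; rewrite /g Ud.
Qed.

Lemma hausdorff1_delta_ge0 d A : 0 <= hausdorff1_delta d A.
Proof. by rewrite hdE; exact: mu_ext_ge0. Qed.

Lemma le_hausdorff1_delta d :
  {homo (hausdorff1_delta d : set (R * R) -> \bar R) :
    A B / A `<=` B >-> A <= B}.
Proof. by move=> A B AB; rewrite !hdE; exact: le_mu_ext. Qed.

Lemma hausdorff1_delta_sigma_subadditive d :
  sigma_subadditive (hausdorff1_delta d : set (R * R) -> \bar R).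
Proof.
move=> F; rewrite hdE; under eq_eseriesr do rewrite hdE.
exact: mu_ext_sigma_subadditive.
Qed.

Lemma hausdorff1_delta_le_eucl_diam d U : eucl_diam U <= d%:E ->
  hausdorff1_delta d U <= eucl_diam U.
Proof.
move=> Ud; apply: ereal_inf_lbound.
exists (fun i => if i == 0%N then U else set0).
  split; last by move=> x Ux; exists 0%N.
  by case=> [|i] //=; rewrite eucl_diam_set0 (le_trans (eucl_diam_ge0 U)).
rewrite nneseries_recl//=; last by move=> k _; exact: eucl_diam_ge0.
by rewrite eseries0 ?adde0// => -[|i] //= _ _; rewrite eucl_diam_set0.
Qed.

Lemma hausdorff1_delta_set0 (d : {posnum R}) :
  hausdorff1_delta d%:num (set0 : set (R * R)) = 0.
Proof.
apply/eqP; rewrite eq_le hausdorff1_delta_ge0 andbT.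
have := @hausdorff1_delta_le_eucl_diam d%:num set0.
by rewrite eucl_diam_set0; apply; rewrite lee_fin.
Qed.

HB.instance Definition _ (d : {posnum R}) := isOuterMeasure.Build R (R * R)%type
  (hausdorff1_delta d%:num) (hausdorff1_delta_set0 d) (hausdorff1_delta_ge0 _)
  (@le_hausdorff1_delta _) (@hausdorff1_delta_sigma_subadditive _).

Lemma eucl_dist_line (x y : R) : eucl_dist (x, 0%R) (y, 0%R) = `|x - y|%R.
Proof. by rewrite /eucl_dist /= subrr expr0n addr0 sqrtr_sqr. Qed.

Lemma eucl_diam_itv_le (a b : R) : (a <= b)%R ->
  eucl_diam (`]a, b] `*` [set 0%R]) <= (b - a)%:E.
Proof.
move=> ab; apply: ge_ereal_sup => _
  [->|[[[x x2] [y y2]] [[/= xab ->] [/= yab ->]] <-]].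
  by rewrite lee_fin subr_ge0.
move: xab yab; rewrite !in_itv/= => /andP[ax xb] /andP[ay yb].
by rewrite eucl_dist_line lee_fin ler_norml; apply/andP; split; lra.
Qed.

Lemma hausdorff1_delta_itv (d : {posnum R}) (a b : R) : (a <= b)%R ->
  hausdorff1_delta d%:num (`]a, b] `*` [set 0%R]) <= (b - a)%:E.
Proof.
move=> ab.
have [n] : exists n : nat, (b - a <= n%:R * d%:num)%R.
  exists (Num.trunc ((b - a) / d%:num)).+1.
  by rewrite -ler_pdivrMr// ltW// truncnS_gt.
elim: n a ab => [|n ih] a ab h.
  have -> : `]a, b]%classic = set0.
    by apply/seteqP; split => // x /=; rewrite in_itv/= => /andP[? ?]; lra.
  by rewrite set0X outer_measure0 lee_fin subr_ge0.
have [bad|bad] := leP (b - a)%R d%:num.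
  rewrite (le_trans _ (eucl_diam_itv_le ab))// hausdorff1_delta_le_eucl_diam//.
  by rewrite (le_trans (eucl_diam_itv_le ab)).
have -> : (`]a, b] `*` [set 0%R] : set (R * R)) =
    (`]a, (a + d%:num)%R] `*` [set 0%R]) `|`
    (`](a + d%:num)%R, b] `*` [set 0%R]).
  apply/seteqP; split => [[x y]|[x y]] /=; rewrite !in_itv/=.
    move=> [/andP[ax xb] ->]; have [xad|xad] := leP x (a + d%:num)%R.
      by left; rewrite ax.
    by right; rewrite xb.
  have d0 : (0 < d%:num)%R by [].
  by move=> [[/andP[p q] ->]|[/andP[p q] ->]]; split => //;
    apply/andP; split; lra.
rewrite (le_trans (outer_measureU2 _ _ _))//.
have aad : (a <= a + d%:num)%R by rewrite lerDl.
have adE : (a + d%:num - a = d%:num)%R by rewrite addrC addKr.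
rewrite (_ : (b - a)%:E = (d%:num)%:E + (b - (a + d%:num))%:E); last first.
  by rewrite -EFinD; congr EFin; ring.
rewrite leeD//.
  have := eucl_diam_itv_le aad; rewrite adE => h1.
  by rewrite (le_trans _ h1)// hausdorff1_delta_le_eucl_diam.
apply: ih; first lra.
by move: h; rewrite -natr1 mulrDl mul1r => h; lra.
Qed.

Let lebesgueE B : lebesgue_measure B =
  ereal_inf [set \sum_(k <oo) wlength idfun (F k) |
    F in @measurable_cover _ (ocitv_type R) B].
Proof. by []. Qed.

Lemma hausdorff1_delta_line_le (d : {posnum R}) B :
  hausdorff1_delta d%:num (B `*` [set 0%R]) <= lebesgue_measure B.
Proof.
rewrite lebesgueE; apply: le_ereal_inf_tmp => _ [F [mF BF] <-].
apply: (@le_trans _ _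
    (hausdorff1_delta d%:num (\bigcup_k (F k `*` [set 0%R])))).
  apply: le_hausdorff1_delta => -[x y] [/BF [k _ Fkx] /= ->].
  by exists k.
apply: (le_trans (outer_measure_sigma_subadditive _ _)).
apply: lee_nneseries => [i _ _|i _]; first exact: outer_measure_ge0.
have [[a b] /= _ abF] := mF i.
rewrite -abF; have [ab|ba] := leP a b.
  by rewrite wlength_itv_bnd// hausdorff1_delta_itv.
rewrite set_itv_ge; last by rewrite bnd_simp -leNgt ltW.
by rewrite set0X outer_measure0 wlength0.
Qed.

Lemma lebesgue_le_eucl_diam B :
  lebesgue_measure B <= eucl_diam (B `*` [set 0%R]).
Proof.
have [->|/set0P[x0 Bx0]] := eqVneq B set0.
  by rewrite measure0 eucl_diam_ge0.
have [->|dfin] := eqVneq (eucl_diam (B `*` [set 0%R])) +oo.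
  by rewrite leey.
have : eucl_diam (B `*` [set 0%R]) \is a fin_num.
  by rewrite ge0_fin_numE ?eucl_diam_ge0// ltey.
move=> /fineK; set l := fine _ => lE.
have dist x y : B x -> B y -> (`|x - y| <= l)%R.
  move=> Bx By; rewrite -lee_fin lE -eucl_dist_line; apply: ereal_sup_ubound.
  by right; exists ((x, 0%R), (y, 0%R)).
have ubB : has_ubound B.
  exists (x0 + l)%R => y By.
  by have := dist _ _ By Bx0; rewrite ler_norml => /andP[_]; lra.
have lbB : has_lbound B.
  exists (x0 - l)%R => y By.
  by have := dist _ _ Bx0 By; rewrite ler_norml => /andP[_]; lra.
have supB x : B x -> (x <= sup B)%R by exact: ub_le_sup.
have infB x : B x -> (inf B <= x)%R by exact: ge_inf.
have Bnz : B !=set0 by exists x0.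
have supinf : (sup B - inf B <= l)%R.
  rewrite lerBlDr; apply: ge_sup => // x Bx.
  rewrite addrC -lerBlDr; apply: lb_le_inf => // y By.
  by have := dist _ _ Bx By; rewrite ler_norml => /andP[_]; lra.
have ii : (inf B <= sup B)%R by rewrite (le_trans (infB _ Bx0))// supB.
rewrite -lE (@le_trans _ _ (lebesgue_measure `[inf B, sup B]))//.
  by apply: le_mu_ext => x Bx /=; rewrite in_itv/= infB// supB.
by rewrite lebesgue_measure_itv/= lte_fin; case: ifP => _;
  rewrite ?lee_fin// (le_trans _ supinf)// subr_ge0.
Qed.

Lemma lebesgue_le_hausdorff1_delta (d : R) B :
  lebesgue_measure B <= hausdorff1_delta d (B `*` [set 0%R]).
Proof.
apply: le_ereal_inf_tmp => _ [U [_ BU] <-].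
pose V i := [set x : R | U i (x, 0%R)].
apply: (@le_trans _ _ (lebesgue_measure (\bigcup_i V i))).
  by apply: le_mu_ext => x Bx; have [|i _ Ui] := BU (x, 0%R); [|exists i].
apply: le_trans; first exact: (mu_ext_sigma_subadditive (measure_ge0 _)).
apply: lee_nneseries => [i _ _|i _]; first exact: mu_ext_ge0.
apply: (le_trans (lebesgue_le_eucl_diam _)).
apply: le_ereal_sup => _ [->|[[p q] [[/= Vp p2] [/= Vq q2]] <-]]; first by left.
right; exists (p, q) => //; move: p q Vp p2 Vq q2.
by move=> [p1 p2] [q1 q2] /= + -> + ->.
Qed.

Lemma hausdorff1_line B : hausdorff1 (B `*` [set 0%R]) = lebesgue_measure B.
Proof.
apply/eqP; rewrite eq_le; apply/andP; split.
  apply: ge_ereal_sup => _ [d /= d0 <-].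
  exact: (hausdorff1_delta_line_le (PosNum d0)).
apply: (le_trans (lebesgue_le_hausdorff1_delta 1 B)).
by apply: ereal_sup_ubound; exists 1%R => //=.
Qed.

End hausdorff_line.

Section source_probability.
Context {R : realType}.
Local Open Scope ereal_scope.
Local Notation leb2 := (@lebesgue_measure R \x @lebesgue_measure R).

Let negprod : set (R * R) := [set z | (z.1 * z.2 < 0)%R].

Lemma measurable_negprod : measurable negprod.
Proof.
have mf : measurable_fun [set: R * R] (fun z => z.1 * z.2)%R.
  by apply: measurable_funM; [exact: measurable_fst|exact: measurable_snd].
rewrite (_ : negprod = (fun z => z.1 * z.2)%R @^-1` `]-oo, 0%R[).
  by rewrite -[X in measurable X]setTI; exact: mf.
by apply/seteqP; split => z /=; rewrite in_itv.
Qed.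

Lemma measurable_source_square : measurable (@source_square R).
Proof. by apply: measurableX. Qed.

Lemma source_density_ge0 (x : R * R) : (0 <= source_density x)%R.
Proof. by rewrite mulr_ge0// ?invr_ge0// indicE. Qed.

Lemma measurable_source_density (D : set (R * R)) :
  measurable_fun D (@source_density R).
Proof.
apply: measurable_funTS; apply: measurable_funM => //.
by apply: measurable_indic; exact: measurable_negprod.
Qed.

Lemma sourceE (A : set (R * R)) : measurable A ->
  source_measure A = (2^-1)%:E * leb2 (negprod `&` (A `&` source_square)).
Proof.
move=> mA.
have mAS : measurable (A `&` source_square) by apply: measurableI => //;
  exact: measurable_source_square.
rewrite /source_measure /source_density; under eq_integral do rewrite EFinM.
rewrite ge0_integralZl_EFin//.
  by rewrite integral_indic//; exact: measurable_negprod.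
apply/measurable_EFinP; apply: measurable_indic; exact: measurable_negprod.
Qed.

Lemma source_set0 : source_measure (set0 : set (R * R)) = 0.
Proof. by rewrite /source_measure set0I integral_set0. Qed.

Lemma source_ge0 (A : set (R * R)) : 0 <= source_measure A.
Proof. by apply: integral_ge0 => x _; rewrite lee_fin source_density_ge0. Qed.

Lemma source_sigma_additive : semi_sigma_additive (@source_measure R).
Proof.
move=> F mF tF mUF; rewrite /source_measure setI_bigcupl.
rewrite ge0_integral_bigcup//=.
- apply: is_cvg_ereal_nneg_natsum_cond => n _ _.
  exact: source_ge0.
- by move=> k; apply: measurableI; [exact: mF|exact: measurable_source_square].
- by apply/measurable_EFinP; exact: measurable_source_density.
- by move=> x _; rewrite lee_fin source_density_ge0.
- exact: trivIset_setIr.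
Qed.

HB.instance Definition _ := isMeasure.Build _ _ _ (@source_measure R)
  source_set0 source_ge0 source_sigma_additive.

Lemma source_setT : source_measure [set: R * R] = 1.
Proof.
rewrite sourceE// setTI.
have -> : negprod `&` source_square =
    (`[(-1)%R, 0%R[ `*` `]0%R, 1%R]) `|` (`]0%R, 1%R] `*` `[(-1)%R, 0%R[).
  apply/seteqP; split => [[x y]|[x y]];
    rewrite /negprod /source_square /= !in_itv/=.
    move=> [xy [/andP[a b] /andP[c d]]].
    have [x0|x0|x0] := ltgtP x 0%R.
    - left; split; [lra|]; apply/andP; split => //; nra.
    - right; split; [lra|]; apply/andP; split => //; nra.
    - by move: xy; rewrite x0 mul0r ltxx.
  move=> [[/andP[a b] /andP[c d]]|[/andP[a b] /andP[c d]]]; split; nra.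
have -> : forall X Y : set (R * R), measurable X -> measurable Y ->
    X `&` Y = set0 -> leb2 (X `|` Y) = leb2 X + leb2 Y.
  by move=> X Y mX mY XY; exact: measureU.
- have leb2_rect (I J : interval R) : leb2 ([set` I] `*` [set` J]) =
      lebesgue_measure [set` I] * lebesgue_measure [set` J].
    by apply: product_measure1E; exact: measurable_itv.
  rewrite !leb2_rect.
  rewrite !lebesgue_measure_itv/= !lte_fin ltrN10 ltr01 -!EFinB -!EFinM.
  congr EFin; lra.
- exact: measurableX.
- exact: measurableX.
- apply/seteqP; split => // -[x y] /=; rewrite !in_itv/=.
  move=> [[/andP[a b] _] [/andP[c d] _]]; lra.
Qed.

HB.instance Definition _ :=
  Measure_isProbability.Build _ _ _ (@source_measure R) source_setT.

End source_probability.

Section target_probability.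
Context {R : realType}.
Local Open Scope ereal_scope.

Let slice (A : set (R * R)) : set R :=
  (fun x => (x, 0%R)) @^-1` A `&` `[(-1)%R, 1%R].

Lemma targetE (A : set (R * R)) :
  target_measure A = (2^-1)%:E * lebesgue_measure (slice A).
Proof.
rewrite /target_measure -hausdorff1_line; congr (_ * hausdorff1 _).
apply/seteqP; split => [[x y] [Axy [/= x1 y0]]|[x y] [[/= Ax x1] y0]].
  by split => //; split => //=; rewrite -y0.
by rewrite /= in y0; rewrite y0.
Qed.

Let measurable_slice A : measurable A -> measurable (slice A).
Proof.
move=> mA; apply: measurableI => //.
rewrite -[X in measurable X]setTI.
by apply: measurable_fun_pair.
Qed.

Lemma target_set0 : target_measure (set0 : set (R * R)) = 0.
Proof. by rewrite targetE /slice preimage_set0 set0I measure0 mule0. Qed.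

Lemma target_ge0 (A : set (R * R)) : 0 <= target_measure A.
Proof. by rewrite targetE mule_ge0// lee_fin invr_ge0. Qed.

Lemma target_sigma_additive : semi_sigma_additive (@target_measure R).
Proof.
move=> F mF tF mUF; rewrite targetE.
have -> : (fun n => \sum_(0 <= i < n) target_measure (F i)) =
    (fun n => (2^-1)%:E * \sum_(0 <= i < n) lebesgue_measure (slice (F i))).
  apply/funext => n; rewrite ge0_sume_distrr//.
  by apply: eq_bigr => i _; rewrite targetE.
apply: cvgeZl => //.
rewrite (_ : slice (\bigcup_n F n) = \bigcup_n slice (F n)); last first.
  by rewrite /slice preimage_bigcup setI_bigcupl.
apply: measure_semi_sigma_additive.
- by move=> i; exact: measurable_slice.
- apply: trivIset_setIr; apply/trivIsetP => /= i j _ _ ij.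
  rewrite -preimage_setI.
  by move/trivIsetP : tF => /(_ _ _ _ _ ij) ->//; rewrite preimage_set0.
- by apply: bigcup_measurable => i _; exact: measurable_slice.
Qed.

HB.instance Definition _ := isMeasure.Build _ _ _ (@target_measure R)
  target_set0 target_ge0 target_sigma_additive.

Lemma target_setT : target_measure [set: R * R] = 1.
Proof.
rewrite targetE /slice preimage_setT setTI lebesgue_measure_itv/= lte_fin.
have -> : (-1 < 1 :> R)%R by lra.
by rewrite -EFinB -EFinM; congr EFin; lra.
Qed.

HB.instance Definition _ :=
  Measure_isProbability.Build _ _ _ (@target_measure R) target_setT.

End target_probability.

Section transport.
Context {R : realType}.
Local Open Scope ereal_scope.

Definition is_transport_map d d' (X : measurableType d) (Y : measurableType d')
    (mu : set X -> \bar R) (nu : set Y -> \bar R) (f : X -> Y) : Prop :=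
  measurable_fun [set: X] f /\
  forall B, measurable B -> pushforward mu f B = nu B.

Definition is_optimal_map (c : R * R -> R * R -> R)
    (mu nu : set (R * R) -> \bar R) (S : R * R -> R * R) : Prop :=
  is_transport_map mu nu S /\
  forall S' : R * R -> R * R, is_transport_map mu nu S' ->
    \int[mu]_x (c x (S x))%:E <= \int[mu]_x (c x (S' x))%:E.

Definition aniso_cost (eps : R) (x y : R * R) : R :=
  (eps * (x.1 - y.1) ^+ 2 + (x.2 - y.2) ^+ 2)%R.

Definition is_monotone_map (m n : set R -> \bar R) (f : R -> R) : Prop :=
  {homo f : s t / (s <= t)%R} /\ is_transport_map m n f.

Definition marginal2 (mu : set (R * R) -> \bar R) : set R -> \bar R :=
  pushforward mu snd.

(* [k] disintegrates [mu] along its second marginal: [k x2] is the law of the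
   first coordinate given that the second one is x2. *)
Definition is_conditional_law1 (mu : set (R * R) -> \bar R)
    (k : R.-pker R ~> R) : Prop :=
  forall A B : set R, measurable A -> measurable B ->
    mu (A `*` B) = \int[marginal2 mu]_(x2 in B) k x2 A.

(* Conditional laws are determined only up to null sets of the second marginal,
   hence the map of the first coordinate is constrained for almost every x2. *)
Definition is_knothe_rosenblatt (mu nu : set (R * R) -> \bar R)
    (T : R * R -> R * R) : Prop :=
  measurable_fun [set: R * R] T /\
  exists (k l : R.-pker R ~> R) (T1 : R -> R -> R) (T2 : R -> R),
    [/\ is_conditional_law1 mu k /\ is_conditional_law1 nu l,
        is_monotone_map (marginal2 mu) (marginal2 nu) T2,
        {ae marginal2 mu, forall x2,
          is_monotone_map (k x2) (l (T2 x2)) (fun x1 => T1 x1 x2)} &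
        forall x1 x2, T (x1, x2) = (T1 x1 x2, T2 x2)].

End transport.

(* Main.v *)
(* A conditional law of mu given x2 is uniform on [-1,0] or on [0,1] according
   to the sign of x2, and that of nu is uniform on [-1,1]; the nondecreasing map
   between them is x1 |-> 2 x1 + sgn x2. Since nu lives on the horizontal axis,
   every transport map pays the same vertical cost, while (x1, x2) |-> (x1, 0)
   pays no horizontal cost and is a transport map because the first marginal of
   mu is uniform on [-1,1]. The optimal map thus does not depend on eps and
   differs from the Knothe-Rosenblatt map on a set of positive measure. *)

Require Import Defs.
From HB Require Import structures.
From mathcomp Require Import all_boot all_order all_algebra.
From mathcomp Require Import all_classical all_reals all_analysis.
From mathcomp Require Import measurable_realfun.
From mathcomp Require Import ring lra.

Set Implicit Arguments.
Unset Strict Implicit.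
Unset Printing Implicit Defensive.

Import Order.TTheory GRing.Theory Num.Theory.
Import numFieldNormedType.Exports.

Local Open Scope classical_set_scope.
Local Open Scope ring_scope.

(** * Lebesgue measure on the line: negligible points and affine maps *)

Section lebesgue_line.
Context {R : realType}.
Local Open Scope ereal_scope.
Local Notation leb := (@lebesgue_measure R).

(** Used to pass between open, half-open and closed intervals: a single point carries no length. *)
Lemma lebesgue_measure_eq_off_point (p : R) (A B : set R) :
  measurable A -> measurable B -> (forall x, x <> p -> A x <-> B x) ->
  leb A = leb B.
Proof.
move=> mA mB AB; rewrite (measureDI leb mA (measurable_set1 p)).
rewrite (measureDI leb mB (measurable_set1 p)).
have null (C : set R) : measurable C -> leb (C `&` [set p]) = 0.
  move=> mC; apply/eqP; rewrite -measure_le0 -(lebesgue_measure_set1 p).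
  by rewrite le_measure// inE; [exact: measurableI|exact: measurable_set1].
congr (_ + _); last exact: (etrans (null _ mA) (esym (null _ mB))).
congr (leb _); by apply/seteqP; split => x [/= Cx xp]; split => //; apply/(AB _ xp).
Qed.

(** The left side is a scaled pushforward of Lebesgue measure; it gives half-open intervals their
    length, so it is Lebesgue measure by uniqueness. *)
Lemma lebesgue_measure_affine (a s : R) (B : set R) : (0 < a)%R ->
  measurable B -> a%:E * leb ((fun x => a * x + s)%R @^-1` B) = leb B.
Proof.
move=> a0 mB.
have mf : measurable_fun [set: measurableTypeR R]
    ((fun x => a * x + s)%R : _ -> measurableTypeR R).
  by apply: measurable_funD => //; exact: mulrl_measurable.
pose m := mscale (NngNum (ltW a0))
  (measure_function_pushforward__canonical__measure_function_Measure leb mf).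
apply/esym; rewrite (_ : a%:E * _ = m B)//.
apply: lebesgue_measure_unique => // _ [[b c]] _ <-.
rewrite /= -[RHS]/(a%:E * leb ((fun x => a * x + s)%R @^-1` `]b, c])).
rewrite [X in _ * leb X](_ : _ =
    `](b - s) / a, (c - s) / a]%classic%R); last first.
  apply/seteqP; split => x /=; rewrite !in_itv/= ltr_pdivrMr// ler_pdivlMr//;
    by rewrite ltrBlDr lerBrDr (mulrC x).
rewrite !lebesgue_measure_itv/= !lte_fin ltr_pM2r ?invr_gt0// ltrD2r.
case: ifP => _; last by rewrite mule0.
by rewrite -!EFinB -EFinM; congr EFin; field; rewrite gt_eqF.
Qed.

End lebesgue_line.

(** * The second marginal as a probability measure *)

Section marginal.
Context {R : realType}.
Local Open Scope ereal_scope.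

Section measure.
Variable mu : {measure set (R * R) -> \bar R}.

Let m : {measure set R -> \bar R} :=
  measure_function_pushforward__canonical__measure_function_Measure mu
    (@measurable_snd _ _ R R).

HB.instance Definition _ := isMeasure.Build _ _ _ (marginal2 mu)
  (measure0 m) (measure_ge0 m) (@measure_semi_sigma_additive _ _ _ m).

End measure.

Variable mu : probability (R * R)%type R.

Let marginal2_setT : marginal2 mu [set: R] = 1.
Proof. exact: probability_setT. Qed.

HB.instance Definition _ :=
  Measure_isProbability.Build _ _ _ (marginal2 mu) marginal2_setT.

End marginal.

(** * Rectangles under the source measure, and the marginals of both measures *)

Section source.
Context {R : realType}.
Local Open Scope ereal_scope.
Local Notation leb := (@lebesgue_measure R).

(** For 0 < |[x2]| <= 1 this is the horizontal slice of the support at height [x2]. At the other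
    heights the slice is empty, and a cell of length 1 is still assigned so that every
    [source_law x2] is a probability. *)
Definition source_cell (x2 : R) : set R :=
  if (0 < x2)%R then `[(-1)%R, 0%R[%classic else `]0%R, 1%R]%classic.

Lemma measurable_source_cell x2 : measurable (source_cell x2).
Proof. by rewrite /source_cell; case: ifP. Qed.

(** The support is the disjoint union of a rectangle in the second quadrant and one in the fourth,
    and the product measure factors on each. *)
Lemma source_setX (A B : set R) : measurable A -> measurable B ->
  source_measure (A `*` B) =
  (2^-1)%:E * (leb (A `&` `[(-1)%R, 0%R[) * leb (B `&` `]0%R, 1%R]) +
               leb (A `&` `]0%R, 1%R]) * leb (B `&` `[(-1)%R, 0%R[)).
Proof.
move=> mA mB; rewrite sourceE; last exact: measurableX.
congr (_ * _).
have mI (C : set R) (I : interval R) : measurable C ->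
    measurable (C `&` [set` I]) by move=> mC; exact: measurableI.
rewrite -!product_measure1E; try exact: mI.
rewrite -measureU.
- congr ((leb \x leb) _).
  apply/seteqP; split => [[x y]|[x y]]; rewrite /source_square /= !in_itv/=.
    move=> [xy [[Ax By] [/andP[a b] /andP[c d]]]].
    have [x0|x0|x0] := ltgtP x 0%R.
    + by left; do 2![split => //]; apply/andP; split => //; nra.
    + by right; do 2![split => //]; apply/andP; split => //; nra.
    + by move: xy; rewrite x0 mul0r ltxx.
  by move=> [|] [[Ax /andP[a b]] [By /andP[c d]]];
    split; [nra|split => //; split; apply/andP; split; lra|
            nra|split => //; split; apply/andP; split; lra].
- by apply: measurableX; exact: mI.
- by apply: measurableX; exact: mI.
- apply/seteqP; split => // -[x y] /=; rewrite !in_itv/=.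
  by move=> [[[_ /andP[a b]] _] [[_ /andP[c d]] _]]; lra.
Qed.

Lemma lebesgue_N10 : leb `[(-1)%R, 0%R[ = 1.
Proof.
by rewrite lebesgue_measure_itv/= lte_fin ltrN10 -EFinB opprK add0r.
Qed.

Lemma lebesgue_01 : leb `]0%R, 1%R] = 1.
Proof. by rewrite lebesgue_measure_itv/= lte_fin ltr01 sube0. Qed.

Lemma source_setTX (B : set R) : measurable B ->
  source_measure ([set: R] `*` B) =
  (2^-1)%:E * (leb (B `&` `]0%R, 1%R]) + leb (B `&` `[(-1)%R, 0%R[)).
Proof.
by move=> mB; rewrite source_setX// !setTI lebesgue_N10 lebesgue_01 !mul1e.
Qed.

(** The first marginal is uniform on [-1,1], since the two cells cover this interval up to the point
    0. This is what makes [flatten_map] a transport map. *)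
Lemma source_setXT (A : set R) : measurable A ->
  source_measure (A `*` [set: R]) =
  (2^-1)%:E * leb (A `&` `[(-1)%R, 1%R]).
Proof.
move=> mA; rewrite source_setX// !setTI lebesgue_N10 lebesgue_01 !mule1.
rewrite -measureU; [|exact: measurableI|exact: measurableI|].
  congr (_ * _); apply: (lebesgue_measure_eq_off_point (p := 0%R)).
  - by apply: measurableU; exact: measurableI.
  - exact: measurableI.
  - move=> x x0; rewrite /= !in_itv/=; split.
      by move=> [|] [Ax /andP[a b]]; split => //; apply/andP; split; lra.
    move=> [Ax /andP[a b]]; have [?|?|//] := ltgtP x 0%R.
      by left; split; rewrite ?a.
    by right; split; rewrite ?b.
apply/seteqP; split => // x /=; rewrite !in_itv/=.
by move=> [[_ /andP[? ?]] [_ /andP[? ?]]]; lra.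
Qed.

Lemma marginal2_source (B : set R) : measurable B ->
  marginal2 source_measure B =
  (2^-1)%:E * (leb (B `&` `]0%R, 1%R]) + leb (B `&` `[(-1)%R, 0%R[)).
Proof.
move=> mB; rewrite -source_setTX//; congr (source_measure _).
by apply/seteqP; split => // x [].
Qed.

Lemma marginal2_target (B : set R) :
  marginal2 target_measure B = \d_(0%R : R) B.
Proof.
rewrite /marginal2 /pushforward targetE diracE.
have [B0|B0] := boolP (0%R \in B).
  rewrite (_ : _ `&` _ = `[(-1)%R, 1%R]%classic).
    rewrite lebesgue_measure_itv/= lte_fin ifT; last by lra.
    by rewrite -EFinB -EFinM; congr EFin; field.
  apply/seteqP; split => x /=; first by case.
  by move=> ?; split => //; exact: set_mem.
rewrite (_ : _ `&` _ = set0) ?measure0 ?mule0//.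
apply/seteqP; split => x //= [] /mem_set; by rewrite (negbTE B0).
Qed.

End source.

(** * Explicit disintegrations and the Knothe-Rosenblatt map they induce *)

Section conditional_laws.
Context {R : realType}.
Local Open Scope ereal_scope.
Local Notation leb := (@lebesgue_measure R).

(* The measurable structure of [R : realType] is convertible but not
   syntactically equal to the one under [lebesgue_measure]. *)
Definition lebesgue_realType (A : set R) : \bar R := leb A.

HB.instance Definition _ := isMeasure.Build _ _ _ lebesgue_realType
  (measure0 leb) (measure_ge0 leb) (@measure_semi_sigma_additive _ _ _ leb).

Definition source_law (x2 : R) : {measure set R -> \bar R} :=
  mrestr lebesgue_realType (measurable_source_cell x2).

Lemma source_law_gt0 (x2 : R) (A : set R) : (0 < x2)%R ->
  source_law x2 A = leb (A `&` `[(-1)%R, 0%R[).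
Proof.
by move=> x20; rewrite -[LHS]/(leb (A `&` source_cell x2)) /source_cell x20.
Qed.

Lemma source_law_le0 (x2 : R) (A : set R) : (x2 <= 0)%R ->
  source_law x2 A = leb (A `&` `]0%R, 1%R]).
Proof.
move=> x20.
by rewrite -[LHS]/(leb (A `&` source_cell x2)) /source_cell ltNge x20.
Qed.

Lemma source_lawE (A : set R) : source_law ^~ A =
  fun x2 => if (0 < x2)%R then leb (A `&` `[(-1)%R, 0%R[)
            else leb (A `&` `]0%R, 1%R]).
Proof.
by apply/funext => x2; case: ltP => x20;
  [rewrite source_law_gt0|rewrite source_law_le0].
Qed.

Let measurable_source_law A : measurable A ->
  measurable_fun [set: R] (source_law ^~ A).
Proof.
move=> mA; rewrite source_lawE; apply: measurable_fun_ifT => //.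
exact: measurable_fun_ltr.
Qed.

HB.instance Definition _ :=
  isKernel.Build _ _ _ _ _ source_law measurable_source_law.

Let source_law_setT x2 : source_law x2 [set: R] = 1.
Proof.
have [x20|x20] := ltP 0%R x2.
  by rewrite source_law_gt0// setTI lebesgue_N10.
by rewrite source_law_le0// setTI lebesgue_01.
Qed.

HB.instance Definition _ :=
  Kernel_isProbability.Build _ _ _ _ _ source_law source_law_setT.

(** The second marginal of the target is a Dirac mass at 0, so a constant kernel disintegrates the
    target. *)
Definition target_law (_ : R) : {measure set R -> \bar R} :=
  mscale (2^-1)%:nng%R (mrestr lebesgue_realType (measurable_itv `[(-1)%R, 1%R])).

Lemma target_lawE (y2 : R) (A : set R) :
  target_law y2 A = (2^-1)%:E * leb (A `&` `[(-1)%R, 1%R]).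
Proof. by []. Qed.

Let measurable_target_law A : measurable A ->
  measurable_fun [set: R] (target_law ^~ A).
Proof. by move=> mA; exact: measurable_cst. Qed.

HB.instance Definition _ :=
  isKernel.Build _ _ _ _ _ target_law measurable_target_law.

Let target_law_setT y2 : target_law y2 [set: R] = 1.
Proof.
rewrite target_lawE setTI lebesgue_measure_itv/= lte_fin ifT; last by lra.
by rewrite -EFinB -EFinM; congr EFin; field.
Qed.

HB.instance Definition _ :=
  Kernel_isProbability.Build _ _ _ _ _ target_law target_law_setT.

Lemma target_setX (A B : set R) : measurable A -> measurable B ->
  target_measure (A `*` B) = target_law 0 A * \d_(0%R : R) B.
Proof.
move=> mA mB; rewrite targetE target_lawE diracE.
have [B0|B0] := boolP (0%R \in B).
  rewrite mule1; congr (_ * leb (_ `&` _)).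
  by apply/seteqP; split => x /=; [case|split => //; exact: set_mem].
rewrite mule0 (_ : _ `&` _ = set0) ?measure0 ?mule0//.
by apply/seteqP; split => x //= [[_ /mem_set]]; rewrite (negbTE B0).
Qed.

Lemma is_conditional_law1_source : is_conditional_law1 source_measure source_law.
Proof.
move=> A B mA mB; rewrite source_setX//.
have mBp : measurable (B `&` `]0%R, +oo[) by exact: measurableI.
have mBn : measurable (B `&` `]-oo, 0%R]) by exact: measurableI.
(* The kernel depends on [x2] only through the truth of 0 < [x2], so the integrand is constant on
   each of the two pieces of [B]. *)
rewrite -[X in \int[_]_(_ in X) _](_ : (B `&` `]0%R, +oo[) `|`
    (B `&` `]-oo, 0%R]) = B); last first.
  rewrite -setIUr -[RHS]setIT; congr (_ `&` _).
  apply/seteqP; split => x //= _; rewrite !in_itv/= andbT.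
  by have [x0|x0] := ltP 0%R x; [left|right].
rewrite ge0_integral_setU//; first last.
- apply/eqP/seteqP; split => // x /=; rewrite !in_itv/= andbT.
  by move=> [[_ /lt_geF->] []].
- by apply: measurable_funTS; exact: measurable_kernel.
rewrite (eq_integral (cst (leb (A `&` `[(-1)%R, 0%R[)))); last first.
  by move=> x; rewrite inE/= in_itv/= andbT => -[_ x0]; rewrite source_law_gt0.
rewrite [X in _ = _ + X](eq_integral (cst (leb (A `&` `]0%R, 1%R])))); last first.
  by move=> x; rewrite inE/= in_itv/= => -[_ x0]; rewrite source_law_le0.
rewrite !integral_cst//= !marginal2_source//.
have -> : B `&` `]0%R, +oo[ `&` `]0%R, 1%R] = B `&` `]0%R, 1%R].
  by apply/seteqP; split => x /=; rewrite !in_itv/= andbT;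
    [case=> -[]|move=> [? /andP[->]]].
have -> : B `&` `]0%R, +oo[ `&` `[(-1)%R, 0%R[ = set0.
  by apply/seteqP; split => x //=; rewrite !in_itv/= andbT;
    move=> [[_ x0] /andP[_]]; rewrite lt_gtF.
have -> : B `&` `]-oo, 0%R] `&` `]0%R, 1%R] = set0.
  by apply/seteqP; split => x //=; rewrite !in_itv/=;
    move=> [[_ x0] /andP[]]; rewrite ltNge x0.
have -> : B `&` `]-oo, 0%R] `&` `[(-1)%R, 0%R[ = B `&` `[(-1)%R, 0%R[.
  by apply/seteqP; split => x /=; rewrite !in_itv/=;
    [case=> -[]|move=> [? /andP[-> x0]]; rewrite x0 (ltW x0)].
rewrite measure0 adde0 add0e !muleA -!(muleC (2^-1)%:E) -!muleA -muleDr//.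
by apply: ge0_adde_def; rewrite inE mule_ge0.
Qed.

Lemma is_conditional_law1_target : is_conditional_law1 target_measure target_law.
Proof.
move=> A B mA mB; rewrite target_setX// (eq_integral (cst (target_law 0 A)))//.
by rewrite integral_cst// -marginal2_target.
Qed.

Lemma is_monotone_map_laws (x2 y2 : R) : x2 != 0%R ->
  is_monotone_map (source_law x2) (target_law y2)
    (fun x1 => 2 * x1 + Num.sg x2)%R.
Proof.
move=> x20; split; first by move=> s t st; rewrite lerD2r ler_pM2l.
split.
  apply: measurable_funD => //; exact: mulrl_measurable.
move=> B mB; rewrite /pushforward target_lawE.
(* [I] is the exact image of the cell under the affine map: [-1,1] with one endpoint removed, namely
   the point [p] below. The slope 2 accounts for the density 1/2 of [target_law]. *)
pose I := if (0 < x2)%R then `[(-1)%R, 1%R[%classic else `](-1)%R, 1%R]%classic : set R.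
have mI : measurable I by rewrite /I; case: ifP.
transitivity (leb ((fun x => 2 * x + Num.sg x2)%R @^-1` (B `&` I))).
  congr (leb _); apply/seteqP; rewrite /source_cell /I.
  move: x20; case: ltgtP => // [x20|x20] _.
    by rewrite gtr0_sg//; split => x /=; rewrite !in_itv/= => -[? /andP[? ?]];
      split => //; apply/andP; split; lra.
  by rewrite ltr0_sg//; split => x /=; rewrite !in_itv/= => -[? /andP[? ?]];
      split => //; apply/andP; split; lra.
have mBI : measurable (B `&` I) by exact: measurableI.
rewrite (_ : leb (B `&` _) = leb (B `&` I)).
  rewrite -(@lebesgue_measure_affine _ 2 (Num.sg x2) _ _ mBI)//.
  by rewrite muleA -EFinM mulVf ?mul1e.
pose p : R := if (0 < x2)%R then 1%R else (-1)%R.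
apply: (lebesgue_measure_eq_off_point (p := p)) => //; first exact: measurableI.
rewrite /p /I => x; case: ifP => _ xp; rewrite /= !in_itv/=;
  (split=> -[Bx /andP[h1 h2]]; split => //; apply/andP; split => //; try exact: ltW).
  by rewrite lt_neqAle h2 andbT; apply/eqP.
by rewrite lt_neqAle h1 andbT eq_sym; apply/eqP.
Qed.

Definition kr_map (x : R * R) : R * R := (2 * x.1 + Num.sg x.2, 0)%R.

Lemma measurable_kr_map : measurable_fun [set: R * R] kr_map.
Proof.
apply: measurable_fun_pair => //; apply: measurable_funD.
  by apply: measurable_funM => //; exact: measurable_fst.
apply: (@measurableT_comp _ _ _ _ _ _ (@Num.sg R)); last exact: measurable_snd.
apply: nondecreasing_measurable => // x y xy.
by case: sgrP => // ?; case: sgrP => // ?; lra.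
Qed.

Lemma is_knothe_rosenblatt_kr_map :
  is_knothe_rosenblatt source_measure target_measure kr_map.
Proof.
split; first exact: measurable_kr_map.
exists source_law, target_law, (fun x1 x2 => 2 * x1 + Num.sg x2)%R, (cst 0%R).
split => //.
- by split; [exact: is_conditional_law1_source|exact: is_conditional_law1_target].
- split => //; split => // B mB.
  rewrite marginal2_target diracE /pushforward.
  have [B0|B0] := boolP (0%R \in B).
    rewrite (_ : _ @^-1` B = setT); first exact: (@probability_setT _ _ _ (marginal2 source_measure)).
    by apply/seteqP; split => // x _; exact: set_mem.
  rewrite (_ : _ @^-1` B = set0) ?measure0//.
  by apply/seteqP; split => // x /= /mem_set; rewrite (negbTE B0).
(* The height 0 is put in the exceptional set: the sign vanishes there, and x1 |-> 2 x1 would send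
   the cell ]0,1] onto ]0,2]. *)
- exists [set 0%R]; split; first exact: measurable_set1.
    rewrite marginal2_source; last exact: measurable_set1.
    rewrite (_ : _ `&` _ = set0); last first.
      by apply/seteqP; split => // x /= [->]; rewrite in_itv/= ltxx.
    rewrite (_ : [set 0%R] `&` _ = set0); last first.
      by apply/seteqP; split => // x /= [->]; rewrite in_itv/= ltxx andbF.
    by rewrite measure0 adde0 mule0.
  move=> x2 /= h; apply/eqP/negPn/negP => x20; apply: h.
  exact: is_monotone_map_laws.
Qed.

End conditional_laws.

(** * Almost everywhere uniqueness of the Knothe-Rosenblatt map *)

Section knothe_rosenblatt_uniqueness.
Context {R : realType}.
Local Open Scope ereal_scope.
Local Notation leb := (@lebesgue_measure R).

(** Both functions of [x2] have integral [mu (A x B)] over every measurable [B], and they are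
    bounded by 1, hence integrable. The exceptional null set depends on [A], so only countably many
    [A] can be treated at once. *)
Lemma conditional_law1_unique (mu : probability (R * R)%type R)
    (k l : R.-pker R ~> R) (A : set R) : measurable A ->
  is_conditional_law1 mu k -> is_conditional_law1 mu l ->
  {ae marginal2 mu, forall x2, k x2 A = l x2 A}.
Proof.
move=> mA kmu lmu.
suff : ae_eq (marginal2 mu) [set: R] (k ^~ A) (l ^~ A).
  by apply: filterS => x2 /(_ I).
apply: integral_ae_eq => //; last 2 first.
- exact: measurable_kernel.
- by move=> B _ mB; rewrite -kmu// -lmu.
apply: (@le_integrable _ _ _ (marginal2 mu) _ measurableT _ (EFin \o cst 1%R)).
- exact: measurable_kernel.
- move=> x _ /=; rewrite gee0_abs// normr1 -(prob_kernel (s := k) x).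
  by rewrite le_measure// inE.
- exact: finite_measure_integrable_cst.
Qed.

Lemma ae_forall_rat d (X : measurableType d) (mu : {measure set X -> \bar R})
    (P : rat -> X -> Prop) :
  (forall q, {ae mu, forall x, P q x}) -> {ae mu, forall x q, P q x}.
Proof.
move=> aeP.
(* The rationals are enumerated by their codes; an integer that codes no rational is sent to 0,
   which merely repeats a condition. *)
have : {ae mu, forall x n, P (odflt 0%R (unpickle n)) x}.
  by apply: ae_foralln => n.
by apply: filterS => x Px q; have := Px (pickle q); rewrite pickleK.
Qed.

(* Only the values of [m] on half-lines with rational endpoints are used:
   these are what disintegration determines outside a single null set. *)
Lemma monotone_map_uniform (m : {measure set R -> \bar R}) (c y2 : R)
    (f : R -> R) :
  (forall q : rat, (c < ratr q < c + 1)%R ->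
    m `]-oo, ratr q]%classic = (ratr q - c)%:E) ->
  is_monotone_map m (target_law y2) f ->
  forall x, (c < x < c + 1)%R -> f x = (2 * (x - c) - 1)%R.
Proof.
move=> mq [fmono [mf fm]] x /andP[cx xc].
have mpre (B : set R) : measurable B -> measurable (f @^-1` B).
  by move=> mB; rewrite -[X in measurable X]setTI; exact: mf.
apply/eqP; rewrite eq_le; apply/andP; split; rewrite leNgt; apply/negP => fx.
- have h : (x < Num.min (c + 1) ((f x + 1) / 2 + c))%R.
    by rewrite lt_min xc/=; lra.
  have [q] := rat_in_itvoo h.
  rewrite in_itv/= lt_min => /andP[xq /andP[qc qf]].
  have : m (f @^-1` `]-oo, f x[) <= m `]-oo, ratr q]%classic.
    rewrite le_measure ?inE//; first exact: mpre.
    move=> y /=; rewrite !in_itv/= => fy; rewrite leNgt; apply/negP => qy.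
    by have := fmono _ _ (ltW (lt_trans xq qy)); rewrite leNgt fy.
  rewrite mq; last by rewrite (lt_trans cx xq).
  rewrite -[m (f @^-1` _)]/(pushforward m f _) fm// target_lawE leNgt => /negP.
  apply.
  have lemin : ((Num.min (f x) 1 + 1)%R)%:E <= leb (`]-oo, f x[ `&` `[(-1)%R, 1%R]).
    apply: (@le_trans _ _ (leb `[(-1)%R, Num.min (f x) 1%R[)).
      rewrite lebesgue_measure_itv/= lte_fin lt_min ifT ?EFinB ?opprK//.
      by apply/andP; split; lra.
    rewrite le_measure ?inE//; first exact: measurableI.
    move=> y /=; rewrite !in_itv/= lt_min => /andP[y1 /andP[yf y2']].
    by rewrite yf y1 (ltW y2').
  apply: (@lt_le_trans _ _ ((2^-1 * (Num.min (f x) 1 + 1))%:E)).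
    rewrite lte_fin; have [_|_] := leP (f x) 1%R; lra.
  by rewrite EFinM lee_pmul2l.
(* Symmetrically, if [f x] is too small, some rational q < x has ]-oo,q] inside the preimage of
   ]-oo, [f x]], whose mass is at most (max([f x], -1) + 1) / 2 < q - c. *)
- have h : (Num.max c ((f x + 1) / 2 + c) < x)%R.
    by rewrite gt_max cx/=; lra.
  have [q] := rat_in_itvoo h.
  rewrite in_itv/= gt_max => /andP[/andP[qc qf] xq].
  have : m `]-oo, ratr q]%classic <= m (f @^-1` `]-oo, f x]).
    rewrite le_measure ?inE//; first exact: mpre.
    move=> y /=; rewrite !in_itv/= => yq.
    by apply: fmono; exact: (le_trans yq (ltW xq)).
  rewrite mq; last by rewrite qc (lt_trans xq xc).
  rewrite -[m (f @^-1` _)]/(pushforward m f _) fm// target_lawE leNgt => /negP.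
  apply.
  have lemax : leb (`]-oo, f x] `&` `[(-1)%R, 1%R]) <= (Num.max (f x) (-1) + 1)%:E.
    apply: (@le_trans _ _ (leb `[(-1)%R, Num.max (f x) (-1)%R])).
      rewrite le_measure ?inE//; first exact: measurableI.
      move=> y /=; rewrite !in_itv/= le_max => -[yf /andP[y1 _]].
      by rewrite yf y1.
    rewrite lebesgue_measure_itv/=; case: ifP => _; first by rewrite -EFinB opprK.
    by rewrite lee_fin -lerBlDr sub0r le_max lexx orbT.
  apply: (@le_lt_trans _ _ ((2^-1 * (Num.max (f x) (-1) + 1))%:E)).
    by rewrite EFinM lee_pmul2l.
  rewrite lte_fin; have [_|_] := leP (f x) (-1)%R; lra.
Qed.

Lemma source_law_gt0_ray (x2 q : R) : (0 < x2)%R -> (-1 < q < 0)%R ->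
  source_law x2 `]-oo, q]%classic = (q + 1)%:E.
Proof.
move=> x20 /andP[q1 q0]; rewrite source_law_gt0//.
rewrite (_ : _ `&` _ = `[(-1)%R, q]%classic); last first.
  apply/seteqP; split => x /=; rewrite !in_itv/=.
    by move=> [-> /andP[->]].
  by move=> /andP[-> xq]; split => //; exact: le_lt_trans q0.
by rewrite lebesgue_measure_itv/= lte_fin q1 -EFinB opprK.
Qed.

Lemma source_law_lt0_ray (x2 q : R) : (x2 < 0)%R -> (0 < q < 1)%R ->
  source_law x2 `]-oo, q]%classic = q%:E.
Proof.
move=> x20 /andP[q0 q1]; rewrite source_law_le0 ?(ltW x20)//.
rewrite (_ : _ `&` _ = `]0%R, q]%classic); last first.
  apply/seteqP; split => x /=; rewrite !in_itv/=.
    by move=> [-> /andP[->]].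
  by move=> /andP[-> xq]; split => //; exact: le_trans (ltW q1).
by rewrite lebesgue_measure_itv/= lte_fin q0 sube0.
Qed.

(** The second marginal has an atom at 0, so the disintegration determines [l] at that very point;
    integrate over {0}. *)
Lemma conditional_law1_target0 (l : R.-pker R ~> R) (A : set R) :
  measurable A -> is_conditional_law1 target_measure l ->
  l 0%R A = target_law 0%R A.
Proof.
move=> mA /(_ A [set 0%R] mA (measurable_set1 0%R)).
rewrite target_setX// diracE mem_set// mule1 => ->.
rewrite (eq_integral (cst (l 0%R A))); last by move=> x; rewrite inE => ->.
by rewrite integral_cst//= marginal2_target diracE mem_set// mule1.
Qed.

Lemma ae_marginal2 (mu : {measure set (R * R) -> \bar R}) (P : R -> Prop) :
  {ae marginal2 mu, forall x2, P x2} -> {ae mu, forall x, P x.2}.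
Proof.
move=> [N [mN N0 PN]]; exists (snd @^-1` N); split => //.
  by rewrite -[X in measurable X]setTI; exact: measurable_snd.
by move=> x nP; apply: PN.
Qed.

(** Vertical lines are null, which gives the strict bound on the first coordinate; it places [x.1]
    in the open interval where [monotone_map_uniform] determines the map. *)
Lemma ae_source_support :
  {ae source_measure, forall x : R * R,
    [/\ (x.1 * x.2 < 0)%R, (`|x.1| < 1)%R & (`|x.2| <= 1)%R]}.
Proof.
have sup : {ae source_measure, forall x : R * R,
    (x.1 * x.2 < 0)%R /\ source_square x}.
  pose N := ~` ([set x : R * R | (x.1 * x.2 < 0)%R] `&` source_square).
  have mN : measurable N.
    by apply: measurableC; apply: measurableI;
      [exact: measurable_negprod|exact: measurable_source_square].
  exists N; split => //.
  rewrite sourceE// (_ : _ `&` _ = set0) ?measure0 ?mule0//.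
  by apply/seteqP; split => // x [/= xn [+ xs]]; apply.
have off (p : R) : {ae source_measure, forall x : R * R, x.1 <> p}.
  exists ([set p] `*` [set: R]); split.
  - exact: measurableX.
  - rewrite source_setXT//.
    suff -> : leb ([set p] `&` `[(-1)%R, 1%R]) = 0 by rewrite mule0.
    apply/eqP; rewrite -measure_le0 -(lebesgue_measure_set1 p).
    by rewrite le_measure// inE; [exact: measurableI|exact: measurable_set1].
  - by move=> x /= /contrapT.
have {off} := conj (off 1%R) (off (-1)%R) => -[off1 offN1].
move: sup off1 offN1; apply: filterS3 => x [x12 [/= x1 x2]] /eqP n1 /eqP nN1.
move: x1 x2; rewrite !in_itv/= => /andP[a b] /andP[c d].
split => //; last by rewrite ler_norml c d.
by rewrite ltr_norml !lt_neqAle a b n1 eq_sym nN1.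
Qed.

(** [T2] vanishes almost everywhere because its image law is a Dirac mass at 0. For almost every
    [x2], [k x2] then agrees with [source_law x2] on all rational half-lines and [l (T2 x2)] is
    [target_law 0], so the uniform case determines [T1]. *)
Lemma knothe_rosenblatt_unique (T : R * R -> R * R) :
  is_knothe_rosenblatt source_measure target_measure T ->
  {ae source_measure, forall x, T x = kr_map x}.
Proof.
move=> [mT [k [l [T1 [T2 [[ksource ltarget] [_ [mT2 T2tr]] T1mono TE]]]]]].
have T20 : {ae marginal2 source_measure, forall x2, T2 x2 = 0%R}.
  have m0 : measurable (~` [set 0%R : R]) by exact: measurableC.
  exists (T2 @^-1` (~` [set 0%R])); split => //.
    by rewrite -[X in measurable X]setTI; exact: mT2.
  rewrite -[LHS]/(pushforward (marginal2 source_measure) T2 _) T2tr//.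
  by rewrite marginal2_target diracE memNset//=; apply.
have kE : {ae marginal2 source_measure, forall x2 (q : rat),
    k x2 `]-oo, ratr q]%classic = source_law x2 `]-oo, ratr q]%classic}.
  apply: ae_forall_rat => q; apply: conditional_law1_unique => //.
  exact: is_conditional_law1_source.
have /ae_marginal2 : {ae marginal2 source_measure, forall x2,
    (forall q : rat, k x2 `]-oo, ratr q]%classic = source_law x2 `]-oo, ratr q]%classic) /\
    T2 x2 = 0%R /\ is_monotone_map (k x2) (target_law 0%R) (T1 ^~ x2)}.
  move: T20 kE T1mono; apply: filterS3 => x2 T20 kE [homoT1 [mT1 T1tr]].
  split => //; split => //; split => //; split => // B mB.
  by rewrite T1tr// T20; exact: conditional_law1_target0.
move: ae_source_support; apply: filterS2.
move=> [x1 x2] /= [x12 x11 _] [kx2 [T2x2 T1x2]].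
rewrite TE T2x2 /kr_map/=; congr pair.
move: x11; rewrite ltr_norml => /andP[x1N1 x11].
(* The constant [c] of [monotone_map_uniform] is the left end of the cell: 0 below the axis, -1
   above it. *)
have [x20|x20|x20] := ltgtP x2 0%R.
- have law (q : rat) : (0 < (ratr q : R) < 0 + 1)%R ->
      k x2 `]-oo, ratr q]%classic = (ratr q - 0)%:E.
    by rewrite add0r subr0 => q01; rewrite kx2; exact: source_law_lt0_ray.
  have T1E := monotone_map_uniform (y2 := 0%R) law T1x2 (x := x1).
  rewrite ltr0_sg// T1E ?subr0// add0r x11 andbT.
  by move: x12; rewrite nmulr_llt0.
- have law (q : rat) : (-1 < (ratr q : R) < -1 + 1)%R ->
      k x2 `]-oo, ratr q]%classic = (ratr q - -1)%:E.
    by rewrite addNr opprK => q01; rewrite kx2; exact: source_law_gt0_ray.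
  have T1E := monotone_map_uniform (y2 := 0%R) law T1x2 (x := x1).
  rewrite gtr0_sg// T1E; first by ring.
  by rewrite addNr x1N1/=; move: x12; rewrite pmulr_llt0.
- by move: x12; rewrite x20 mulr0 ltxx.
Qed.

End knothe_rosenblatt_uniqueness.

(** * Optimality of the vertical projection and its uniqueness *)

Section optimality.
Context {R : realType}.
Local Open Scope ereal_scope.

Definition flatten_map (x : R * R) : R * R := (x.1, 0%R).

Lemma measurable_flatten_map : measurable_fun [set: R * R] flatten_map.
Proof. by apply: measurable_fun_pair => //; exact: measurable_fst. Qed.

Lemma is_transport_map_flatten :
  is_transport_map source_measure target_measure flatten_map.
Proof.
split; first exact: measurable_flatten_map.
move=> B mB; rewrite targetE /pushforward.
have mB0 : measurable ((fun x => (x, 0%R)) @^-1` B).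
  by rewrite -[X in measurable X]setTI; exact: measurable_fun_pair.
rewrite -source_setXT//; congr (source_measure _).
by apply/seteqP; split => x //= [].
Qed.

(** The complement of the axis is null for the target, hence so is its preimage for the source. *)
Lemma transport_map_snd_ae0 (S : R * R -> R * R) :
  is_transport_map source_measure target_measure S ->
  {ae source_measure, forall x, (S x).2 = 0%R}.
Proof.
move=> [mS Str]; have m0 : measurable (snd @^-1` (~` [set 0%R : R]) : set (R * R)).
  rewrite -[X in measurable X]setTI; apply: measurable_snd => //.
  exact: measurableC.
exists (S @^-1` (snd @^-1` (~` [set 0%R]))); split => //.
  by rewrite -[X in measurable X]setTI; exact: mS.
rewrite -[LHS]/(pushforward source_measure S _) Str//.
rewrite -[LHS]/(marginal2 target_measure _) marginal2_target.
by rewrite diracE memNset//=; apply.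
Qed.

Lemma measurable_transport_component (S : R * R -> R * R) :
  measurable_fun [set: R * R] S ->
  measurable_fun [set: R * R] (fun x => (S x).1) /\
  measurable_fun [set: R * R] (fun x => (S x).2).
Proof.
move=> mS; split.
- exact: (measurableT_comp measurable_fst mS).
- exact: (measurableT_comp measurable_snd mS).
Qed.

Lemma measurable_sqr_sub (f g : R * R -> R) :
  measurable_fun [set: R * R] f -> measurable_fun [set: R * R] g ->
  measurable_fun [set: R * R] (fun x => (f x - g x) ^+ 2)%R.
Proof. by move=> mf mg; apply: measurable_funX; exact: measurable_funB. Qed.

Lemma measurable_sqr_sub_fst (S : R * R -> R * R) :
  measurable_fun [set: R * R] S ->
  measurable_fun [set: R * R] (fun x => ((x.1 - (S x).1) ^+ 2)%:E).
Proof.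
move=> /measurable_transport_component[mS1 _]; apply/measurable_EFinP.
by apply: measurable_sqr_sub => //; exact: measurable_fst.
Qed.

Lemma measurable_sqr_snd :
  measurable_fun [set: R * R] (fun x => (x.2 ^+ 2)%:E).
Proof.
by apply/measurable_EFinP; apply: measurable_funX; exact: measurable_snd.
Qed.

(* The target is carried by the axis [y.2 = 0], so the vertical part of the
   cost is the same for all transport maps. *)
Lemma transport_cost (eps : R) (S : R * R -> R * R) : (0 < eps)%R ->
  is_transport_map source_measure target_measure S ->
  \int[source_measure]_x (aniso_cost eps x (S x))%:E =
  eps%:E * \int[source_measure]_x ((x.1 - (S x).1) ^+ 2)%:E +
  \int[source_measure]_x (x.2 ^+ 2)%:E.
Proof.
move=> eps0 Str; have [mS1 mS2] := measurable_transport_component Str.1.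
have mf := measurable_sqr_sub_fst Str.1.
rewrite -ge0_integralZl_EFin//; last 2 first.
- by move=> x _; rewrite lee_fin sqr_ge0.
- exact: ltW.
have mepsf : measurable_fun [set: R * R]
    (fun x => eps%:E * ((x.1 - (S x).1) ^+ 2)%:E).
  by apply: emeasurable_funM => //; exact: measurable_cst.
rewrite -ge0_integralD//; last 3 first.
- by move=> x _; rewrite mule_ge0// lee_fin ?sqr_ge0// ltW.
- by move=> x _; rewrite lee_fin sqr_ge0.
- exact: measurable_sqr_snd.
apply: ge0_ae_eq_integral => //.
- apply/measurable_EFinP; apply: measurable_funD.
    by apply: measurable_funM => //; exact/measurable_EFinP.
  by apply: measurable_sqr_sub => //; exact: measurable_snd.
- by apply: emeasurable_funD => //; exact: measurable_sqr_snd.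
- move=> x _; rewrite lee_fin; apply: addr_ge0; last exact: sqr_ge0.
  by apply: mulr_ge0; [exact: ltW|exact: sqr_ge0].
- move=> x _; apply: adde_ge0; last by rewrite lee_fin sqr_ge0.
  by apply: mule_ge0; rewrite lee_fin ?sqr_ge0// ltW.
move: (transport_map_snd_ae0 Str); apply: filterS => x S2 _.
by rewrite /aniso_cost S2 subr0 EFinD EFinM.
Qed.

(** Finiteness allows the vertical cost to be cancelled when comparing two total costs in the
    extended reals. *)
Lemma vertical_cost_fin_num :
  \int[@source_measure R]_x (x.2 ^+ 2)%:E \is a fin_num.
Proof.
rewrite ge0_fin_numE; last by apply: integral_ge0 => x _; rewrite lee_fin sqr_ge0.
apply: (@le_lt_trans _ _ (\int[@source_measure R]_x 1)).
  apply: ae_ge0_le_integral => //.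
  - by move=> x _; rewrite lee_fin sqr_ge0.
  - exact: measurable_sqr_snd.
  move: (@ae_source_support R); apply: filterS => x [_ _ x2] _.
  by rewrite lee_fin -real_normK ?num_real// exprn_ile1.
by rewrite integral_cst// mul1e /= source_setT ltry.
Qed.

Lemma flatten_map_cost (eps : R) : (0 < eps)%R ->
  \int[source_measure]_x (aniso_cost eps x (flatten_map x))%:E =
  \int[@source_measure R]_x (x.2 ^+ 2)%:E.
Proof.
move=> eps0; apply: eq_integral => x _.
by rewrite /aniso_cost /= subrr expr0n mulr0 add0r subr0.
Qed.

Lemma is_optimal_map_flatten (eps : R) : (0 < eps)%R ->
  is_optimal_map (aniso_cost eps) source_measure target_measure flatten_map.
Proof.
move=> eps0; split; first exact: is_transport_map_flatten.
move=> S Str; rewrite flatten_map_cost// transport_cost// leeDr// mule_ge0//.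
  by rewrite lee_fin ltW.
by apply: integral_ge0 => x _; rewrite lee_fin sqr_ge0.
Qed.

(** Comparison with [flatten_map] leaves a horizontal cost that is at most 0. A nonnegative
    integrand with zero integral vanishes almost everywhere, so [S] preserves the first
    coordinate. *)
Lemma optimal_map_unique (eps : R) (S : R * R -> R * R) : (0 < eps)%R ->
  is_optimal_map (aniso_cost eps) source_measure target_measure S ->
  {ae source_measure, forall x, S x = flatten_map x}.
Proof.
move=> eps0 [Str Sopt].
have := Sopt _ is_transport_map_flatten.
rewrite flatten_map_cost// transport_cost//.
rewrite -[leRHS]add0e leeD2rE ?vertical_cost_fin_num// pmule_rle0// => le0.
have : \int[source_measure]_x `|((x.1 - (S x).1) ^+ 2)%:E| = 0.
  apply/eqP; rewrite eq_le integral_ge0// andbT (le_trans _ le0)//.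
  by under eq_integral do rewrite gee0_abs ?lee_fin ?sqr_ge0//.
move/ae_eq_integral_abs => /(_ measurableT (measurable_sqr_sub_fst Str.1)).
move: (transport_map_snd_ae0 Str); apply: filterS2 => x S2 /(_ I) [] /eqP.
rewrite sqrf_eq0 subr_eq0 => /eqP S1.
by rewrite [LHS]surjective_pairing S2 -S1.
Qed.

End optimality.

(** * The two limit candidates differ on a set of positive mass *)

Section separation_of_the_maps.
Context {R : realType}.
Local Open Scope ereal_scope.
Local Notation leb := (@lebesgue_measure R).

Lemma measurable_eucl_dist (S T : R * R -> R * R) :
  measurable_fun [set: R * R] S -> measurable_fun [set: R * R] T ->
  measurable_fun [set: R * R] (fun x => eucl_dist (S x) (T x)).
Proof.
move=> /measurable_transport_component[mS1 mS2].
move=> /measurable_transport_component[mT1 mT2].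
apply: (@measurableT_comp _ _ _ _ _ _ (@Num.sqrt R)).
  by apply: nondecreasing_measurable => // x y; exact: ler_wsqrtr.
by apply: measurable_funD; exact: measurable_sqr_sub.
Qed.

Lemma measurable_dist_ge (delta : R) (S T : R * R -> R * R) :
  measurable_fun [set: R * R] S -> measurable_fun [set: R * R] T ->
  measurable [set x | (delta <= eucl_dist (S x) (T x))%R].
Proof.
move=> mS mT; rewrite (_ : [set _ | _] =
    (fun x => eucl_dist (S x) (T x)) @^-1` `[delta, +oo[).
  by rewrite -[X in measurable X]setTI; exact: measurable_eucl_dist.
by apply/seteqP; split => x /=; rewrite in_itv/= andbT.
Qed.

Lemma source_dist_flatten_kr :
  source_measure
    [set x : R * R | (2^-1 <= eucl_dist (flatten_map x) (kr_map x))%R] != 0.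
Proof.
set D := [set x | _].
have mD : measurable D.
  by apply: measurable_dist_ge; [exact: measurable_flatten_map|
    exact: measurable_kr_map].
(* Above the axis the distance is |x - (2x + 1)| = |x + 1|, at least 1/2 once x >= -1/2. This
   rectangle has source mass 1/4. *)
have sub : `[(- 2^-1)%R, 0%R] `*` `]0%R, 1%R] `<=` D.
  move=> [x y] /=; rewrite !in_itv/= => -[/andP[a b] /andP[c d]].
  rewrite /D /= eucl_dist_line gtr0_sg// ler_normr; apply/orP; right => /=; lra.
have mX : measurable (`[(- 2^-1)%R, 0%R] `*` `]0%R, 1%R] : set (R * R)).
  exact: measurableX.
apply/negP => /eqP D0.
have : source_measure (`[(- 2^-1)%R, 0%R] `*` `]0%R, 1%R] : set (R * R)) <= 0.
  by rewrite -D0 le_measure ?inE.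
rewrite source_setX// setIid.
rewrite [X in leb X * _ + _](_ : _ = `[(- 2^-1)%R, 0%R[%classic); last first.
  by apply/seteqP; split => x /=; rewrite !in_itv/=;
    [move=> [/andP[-> _] /andP[_ ->]]|
     move=> /andP[a b]; split; apply/andP; split => //; lra].
rewrite [X in _ + leb X * _](_ : _ = set0); last first.
  apply/seteqP; split => // x /=; rewrite !in_itv/=.
  by move=> [/andP[a b] /andP[c d]]; clear D0; lra.
rewrite measure0 mul0e adde0 lebesgue_01 mule1 lebesgue_measure_itv/= lte_fin.
rewrite ifT; last by lra.
by rewrite -EFinB -EFinM lee_fin; clear D0; lra.
Qed.

Lemma flatten_kr_not_ae_eq :
  ~ {ae source_measure, forall x : R * R, flatten_map x = kr_map x}.
Proof.
move=> [N [mN N0 subN]]; move/negP: source_dist_flatten_kr; apply.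
rewrite -measure_le0 -N0 le_measure ?inE//.
  by apply: measurable_dist_ge; [exact: measurable_flatten_map|
    exact: measurable_kr_map].
move=> x /= h; apply: subN => /= e; move: h; rewrite e /eucl_dist !subrr.
by rewrite expr0n addr0 sqrtr0; lra.
Qed.

End separation_of_the_maps.

(** * Failure of convergence in three modes *)

Section no_convergence.
Context {R : realType}.
Local Open Scope ereal_scope.

Lemma ae_iff_eq_measure d (X : measurableType d)
    (mu : {measure set X -> \bar R}) (A B : set X) :
  measurable A -> measurable B -> {ae mu, forall x, A x <-> B x} ->
  mu A = mu B.
Proof.
move=> mA mB [N [mN N0 AB]].
rewrite -(measureU0 mA mN N0) -(measureU0 mB mN N0); congr (mu _).
apply/seteqP; split => x [|Nx]; try by right.
- move=> Ax; have [Nx|nNx] := pselect (N x); first by right.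
  left; have [+ _] : A x <-> B x by apply: contrapT => /AB.
  exact.
- move=> Bx; have [Nx|nNx] := pselect (N x); first by right.
  left; have [_] : A x <-> B x by apply: contrapT => /AB.
  exact.
Qed.

Lemma harmonic_cvg_at_right0 : (@harmonic R) n @[n --> \oo] --> 0%R^'+.
Proof.
move=> P P0; have : \forall n \near \oo, (0 < @harmonic R n)%R -> P (harmonic n).
  exact: (@cvg_harmonic R _ P0).
by apply: filterS => n; apply; exact: harmonic_gt0.
Qed.

(** The integrals and measures under study are the same for all [eps] > 0, so convergence to 0 would
    force this common value to be 0. *)
Lemma cvg_at_right0_cst (f : R -> \bar R) (c l : \bar R) :
  (forall eps, (0 < eps)%R -> f eps = c) ->
  f eps @[eps --> 0%R^'+] --> l -> c = l.
Proof.
move=> fc fl; apply: (@cvg_unique _ (@ereal_hausdorff R) (f @ 0%R^'+)) => //.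
by apply: cvg_near_cst; near=> eps; apply: fc.
Unshelve. all: by end_near. Qed.

Variables (S : R -> R * R -> R * R) (T : R * R -> R * R).
Hypothesis Sopt : forall eps, (0 < eps)%R ->
  is_optimal_map (aniso_cost eps) source_measure target_measure (S eps).
Hypothesis TKR : is_knothe_rosenblatt source_measure target_measure T.

Let measurable_S eps : (0 < eps)%R -> measurable_fun [set: R * R] (S eps).
Proof. by move=> /Sopt[[]]. Qed.

Let measurable_T : measurable_fun [set: R * R] T.
Proof. by case: TKR. Qed.

Let ae_ST eps : (0 < eps)%R ->
  {ae source_measure, forall x, S eps x = flatten_map x /\ T x = kr_map x}.
Proof.
move=> eps0; have := optimal_map_unique eps0 (Sopt eps0).
by have := knothe_rosenblatt_unique TKR; apply: filterS2.
Qed.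

Let measurable_sqr_dist (F G : R * R -> R * R) :
  measurable_fun [set: R * R] F -> measurable_fun [set: R * R] G ->
  measurable_fun [set: R * R] (fun x => (eucl_dist (F x) (G x) ^+ 2)%:E).
Proof.
move=> mF mG; apply/measurable_EFinP; apply: measurable_funX.
exact: measurable_eucl_dist.
Qed.

(** Convergence would make the constant squared distance between [flatten_map] and [kr_map] zero, so
    that these maps would agree almost everywhere. *)
Lemma optimal_maps_not_cvg_L2 :
  ~ (\int[source_measure]_x ((eucl_dist (S eps x) (T x)) ^+ 2)%:E
       @[eps --> 0%R^'+] --> 0).
Proof.
move/(cvg_at_right0_cst (c := \int[@source_measure R]_x
  ((eucl_dist (flatten_map x) (kr_map x)) ^+ 2)%:E)) => int0.
have mfk := measurable_sqr_dist (@measurable_flatten_map R)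
  (@measurable_kr_map R).
have /int0 {}int0 : forall eps, (0 < eps)%R ->
    \int[source_measure]_x ((eucl_dist (S eps x) (T x)) ^+ 2)%:E =
    \int[source_measure]_x ((eucl_dist (flatten_map x) (kr_map x)) ^+ 2)%:E.
  move=> eps eps0; apply: ge0_ae_eq_integral => //.
  - by apply: measurable_sqr_dist => //; exact: measurable_S.
  - by move=> x _; rewrite lee_fin sqr_ge0.
  - by move=> x _; rewrite lee_fin sqr_ge0.
  by move: (ae_ST eps0); apply: filterS => x [-> ->].
apply: (@flatten_kr_not_ae_eq R).
have : \int[@source_measure R]_x
    `|((eucl_dist (flatten_map x) (kr_map x)) ^+ 2)%:E| = 0.
  by rewrite -int0; apply: eq_integral => x _; rewrite gee0_abs// lee_fin sqr_ge0.
move/ae_eq_integral_abs => /(_ measurableT mfk).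
apply: filterS => x /(_ I) [] /eqP.
rewrite sqrf_eq0 eucl_dist_line normr_eq0 subr_eq0 => /eqP x1.
by rewrite /flatten_map [in LHS]x1.
Qed.

Lemma optimal_maps_not_cvg_in_measure :
  ~ (forall delta : R, (0 < delta)%R ->
       source_measure [set x | (delta <= eucl_dist (S eps x) (T x))%R]
         @[eps --> 0%R^'+] --> 0).
Proof.
have half_gt0 : (0 < 2^-1 :> R)%R by rewrite invr_gt0.
(* The threshold 1/2 is the one for which [source_dist_flatten_kr] gives nonzero mass. *)
move=> /(_ _ half_gt0) meas0.
move/negP: (@source_dist_flatten_kr R); apply; apply/eqP.
apply: cvg_at_right0_cst meas0 => eps eps0.
apply: ae_iff_eq_measure.
- by apply: measurable_dist_ge => //; exact: measurable_S.
- by apply: measurable_dist_ge;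
    [exact: measurable_flatten_map|exact: measurable_kr_map].
by move: (ae_ST eps0); apply: filterS => x /= [-> ->].
Qed.

(* For each eps, [S eps] is known only off a null set, so the limit is taken
   along a sequence of parameters to keep the exceptional set null. *)
Lemma optimal_maps_not_cvg_ae :
  ~ {ae source_measure, forall x, S eps x @[eps --> 0%R^'+] --> T x}.
Proof.
move=> Scvg; apply: (@flatten_kr_not_ae_eq R).
have aeS : {ae source_measure, forall x n,
    S (harmonic n) x = flatten_map x /\ T x = kr_map x}.
  by apply: ae_foralln => n; apply: ae_ST; exact: harmonic_gt0.
move: Scvg aeS; apply: filterS2 => x Sx STx.
have Txkr : T x = kr_map x by have [] := STx 0%N.
(* Both maps have second coordinate 0. Along the harmonic sequence the first coordinate is
   constantly [x.1], which must therefore equal its limit. *)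
suff x1 : x.1 = (kr_map x).1 by rewrite /flatten_map [in LHS]x1.
have cvg1 : (S (harmonic n) x).1 @[n --> \oo] --> (T x).1.
  have cvgS := cvg_comp _ _ harmonic_cvg_at_right0 Sx.
  exact: (cvg_comp _ _ cvgS cvg_fst).
rewrite -Txkr.
apply: (@cvg_unique _ (@norm_hausdorff _ R) _ _ _ _ _ cvg1).
by apply: cvg_near_cst; apply: nearW => n; rewrite (STx n).1.
Qed.

End no_convergence.

Theorem mainTheorem2 (R : realType) :
  [/\ (* the Knothe-Rosenblatt map *)
      let TKR := fun x : R * R => (2 * x.1 + Num.sg x.2, 0) : R * R in
      is_knothe_rosenblatt source_measure target_measure TKR /\
      forall T : R * R -> R * R, is_knothe_rosenblatt source_measure target_measure T ->
        {ae source_measure, forall x, T x = TKR x},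
      (* the optimal transport maps *)
      forall eps : R, 0 < eps ->
      let T0 := fun x : R * R => (x.1, 0) : R * R in
      is_optimal_map (aniso_cost eps) source_measure target_measure T0 /\
      forall S : R * R -> R * R,
        is_optimal_map (aniso_cost eps) source_measure target_measure S ->
        {ae source_measure, forall x, S x = T0 x} &
      (* no convergence in L^2, in measure, or almost everywhere *)
      forall (S : R -> R * R -> R * R) (T : R * R -> R * R),
        (forall eps, 0 < eps ->
          is_optimal_map (aniso_cost eps) source_measure target_measure (S eps)) ->
        is_knothe_rosenblatt source_measure target_measure T ->
        [/\ ~ ((\int[source_measure]_x ((eucl_dist (S eps x) (T x)) ^+ 2)%:E)%E
                 @[eps --> 0^'+] --> 0%E),
            ~ (forall delta : R, 0 < delta ->
                 source_measure [set x | delta <= eucl_dist (S eps x) (T x)]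
                 @[eps --> 0^'+] --> 0%E) &
            ~ {ae source_measure, forall x, S eps x @[eps --> 0^'+] --> T x}]].
Proof.
split.
- move=> TKR; split; first exact: is_knothe_rosenblatt_kr_map.
  by move=> T /knothe_rosenblatt_unique.
- move=> eps eps0 T0; split; first exact: is_optimal_map_flatten.
  by move=> S /(optimal_map_unique eps0).
- move=> S T Sopt TKR; split.
  + exact: optimal_maps_not_cvg_L2.
  + exact: optimal_maps_not_cvg_in_measure.
  + exact: optimal_maps_not_cvg_ae.
Qed.
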